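(* For every Lie algebra $L$ over $\mathbb Z$, we have $\delta_3(L)=\gamma_3(L)$.
   Context: $L$ is a Lie ring, i.e. a Lie algebra over $\mathbb Z$. Its lower central series is $\gamma_1(L)=L$ and, for $n\ge 1$, $\gamma_{n+1}(L)$ is the additive subgroup generated by all $[x,y]$ with $x\in L$, $y\in\gamma_n(L)$. $\mathscr U(L)$ is the universal enveloping algebra of $L$ over $\mathbb Z$, $\iota:L\to\mathscr U(L)$ is the natural map (injective over $\mathbb Z$), and $\varpi(L)$ is the augmentation ideal of $\mathscr U(L)$, i.e. the two-sided ideal generated by $\iota(L)$; $\varpi^n(L)$ is its $n$th power. The $n$th Lie dimension subring is $\delta_n(L)=L\cap\varpi^n(L)=\{x\in L:\iota(x)\in\varpi^n(L)\}$, $n\ge1$. *)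

(* Defs.v *)
From HB Require Import structures.
From mathcomp Require Import all_boot all_order all_algebra.
From mathcomp Require Import generic_quotient.
From mathcomp Require Import boolp classical_sets.

Set Implicit Arguments.
Unset Strict Implicit.
Unset Printing Implicit Defensive.

Import GRing.Theory.
Local Open Scope quotient_scope.
Local Open Scope classical_set_scope.
Local Open Scope ring_scope.

HB.mixin Record Zmodule_isLieRing L of GRing.Zmodule L := {
  bracket : L -> L -> L;
  bracketDl : left_distributive bracket +%R;
  bracketDr : right_distributive bracket +%R;
  bracketxx : forall x, bracket x x = 0;
  jacobi : forall x y z,
    bracket x (bracket y z) + bracket y (bracket z x)
      + bracket z (bracket x y) = 0
}.

#[short(type="lieRingType")]
HB.structure Definition LieRing := {L of GRing.Zmodule L & Zmodule_isLieRing L}.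

Definition subgroup_closed (V : zmodType) (H : set V) : Prop :=
  H 0 /\ (forall x y, H x -> H y -> H (x - y)).

Definition ideal_closed (R : pzRingType) (I : set R) : Prop :=
  [/\ subgroup_closed I,
      forall a x, I x -> I (a * x) &
      forall a x, I x -> I (x * a)].

Definition subgroup_gen (V : zmodType) (S : set V) : set V :=
  smallest (@subgroup_closed V) S.

Definition ideal_gen (R : pzRingType) (S : set R) : set R :=
  smallest (@ideal_closed R) S.

Definition ideal_mul (R : pzRingType) (I J : set R) : set R :=
  subgroup_gen [set a * b | a in I & b in J].

Fixpoint ideal_exp (R : pzRingType) (I : set R) (n : nat) : set R :=
  if n is m.+1 then ideal_mul I (ideal_exp I m) else setT.

Lemma ideal_exp1 (R : pzRingType) (I : set R) :
  ideal_closed I -> ideal_exp I 1 = I.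
Proof.
case=> Isub _ Ir; apply/seteqP; split=> x /=.
  by apply; split=> // _ [a Ia [b _ <-]]; apply: Ir.
by move=> Ix; apply: sub_gen_smallest; exists x => //; exists 1; rewrite ?mulr1.
Qed.

(* The lower central series starts at index 1; lcs L 0 is also the whole of L. *)
Section LowerCentralSeries.
Variable L : lieRingType.

Fixpoint lcs (n : nat) : set L :=
  match n with
  | 0 | 1 => setT
  | m.+1 => subgroup_gen [set bracket x y | x in setT & y in lcs m]
  end.

End LowerCentralSeries.
Arguments lcs : clear implicits.

(* The universal enveloping algebra over Z is presented as the ring generated
   by L, subject to the additivity of the inclusion of generators and to
   [x, y] = x y - y x: formal ring expressions in the elements of L modulo the
   least congruence imposing the ring axioms and these two relations.
   Its universal property is proved below. *)
Section EnvelopingAlgebra.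
Variable L : lieRingType.

Inductive env_term : Type :=
| EGen of L
| EZero
| EOne
| EOpp of env_term
| EAdd of env_term & env_term
| EMul of env_term & env_term.

Inductive env_cong : env_term -> env_term -> Prop :=
| EC_refl a : env_cong a a
| EC_sym a b : env_cong a b -> env_cong b a
| EC_trans a b c : env_cong a b -> env_cong b c -> env_cong a c
| EC_opp a b : env_cong a b -> env_cong (EOpp a) (EOpp b)
| EC_add a b c d :
    env_cong a b -> env_cong c d -> env_cong (EAdd a c) (EAdd b d)
| EC_mul a b c d :
    env_cong a b -> env_cong c d -> env_cong (EMul a c) (EMul b d)
| EC_addA a b c : env_cong (EAdd a (EAdd b c)) (EAdd (EAdd a b) c)
| EC_addC a b : env_cong (EAdd a b) (EAdd b a)
| EC_add0 a : env_cong (EAdd EZero a) a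
| EC_addN a : env_cong (EAdd (EOpp a) a) EZero
| EC_mulA a b c : env_cong (EMul a (EMul b c)) (EMul (EMul a b) c)
| EC_mul1l a : env_cong (EMul EOne a) a
| EC_mul1r a : env_cong (EMul a EOne) a
| EC_mulDl a b c :
    env_cong (EMul (EAdd a b) c) (EAdd (EMul a c) (EMul b c))
| EC_mulDr a b c :
    env_cong (EMul a (EAdd b c)) (EAdd (EMul a b) (EMul a c))
| EC_gen_add x y : env_cong (EGen (x + y)) (EAdd (EGen x) (EGen y))
| EC_gen_bracket x y :
    env_cong (EGen (bracket x y))
      (EAdd (EMul (EGen x) (EGen y)) (EOpp (EMul (EGen y) (EGen x)))).

HB.instance Definition _ := gen_eqMixin env_term.
HB.instance Definition _ := gen_choiceMixin env_term.

Definition env_rel : rel env_term := fun a b => `[< env_cong a b >].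

Lemma env_rel_refl : reflexive env_rel.
Proof. by move=> a; apply/asboolP; apply: EC_refl. Qed.

Lemma env_rel_sym : symmetric env_rel.
Proof. by move=> a b; apply/asboolP/asboolP; apply: EC_sym. Qed.

Lemma env_rel_trans : transitive env_rel.
Proof.
by move=> b a c /asboolP ab /asboolP bc; apply/asboolP; apply: EC_trans bc.
Qed.

Canonical env_equiv := EquivRel env_rel env_rel_refl env_rel_sym env_rel_trans.

Definition env : Type := {eq_quot env_equiv}.
HB.instance Definition _ : EqQuotient env_term env_equiv env :=
  EqQuotient.on env.
HB.instance Definition _ := Choice.on env.

Lemma env_piP (a b : env_term) : \pi_env a = \pi_env b <-> env_cong a b.
Proof. by split=> [/eqmodP/asboolP|ab] //; apply/eqmodP/asboolP. Qed.

Lemma env_repr_pi (a : env_term) : env_cong (repr (\pi_env a)) a.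
Proof. by apply/env_piP; rewrite reprK. Qed.

Definition env_zero : env := \pi_env EZero.
Definition env_one : env := \pi_env EOne.
Definition env_opp (u : env) : env := \pi_env (EOpp (repr u)).
Definition env_add (u v : env) : env := \pi_env (EAdd (repr u) (repr v)).
Definition env_mul (u v : env) : env := \pi_env (EMul (repr u) (repr v)).

Lemma env_pi_opp a : env_opp (\pi_env a) = \pi_env (EOpp a).
Proof. by apply/env_piP/EC_opp/env_repr_pi. Qed.

Lemma env_pi_add a b : env_add (\pi_env a) (\pi_env b) = \pi_env (EAdd a b).
Proof. by apply/env_piP/EC_add; apply: env_repr_pi. Qed.

Lemma env_pi_mul a b : env_mul (\pi_env a) (\pi_env b) = \pi_env (EMul a b).
Proof. by apply/env_piP/EC_mul; apply: env_repr_pi. Qed.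

Lemma env_addA : associative env_add.
Proof.
by elim/quotW=> a; elim/quotW=> b; elim/quotW=> c;
  rewrite (env_pi_add b c) (env_pi_add a b) !env_pi_add;
  apply/env_piP/EC_addA.
Qed.

Lemma env_addC : commutative env_add.
Proof.
by elim/quotW=> a; elim/quotW=> b; rewrite !env_pi_add; apply/env_piP/EC_addC.
Qed.

Lemma env_add0 : left_id env_zero env_add.
Proof. by elim/quotW=> a; rewrite env_pi_add; apply/env_piP/EC_add0. Qed.

Lemma env_addN : left_inverse env_zero env_opp env_add.
Proof. by elim/quotW=> a; rewrite env_pi_opp env_pi_add; apply/env_piP/EC_addN. Qed.

HB.instance Definition _ :=
  GRing.isZmodule.Build env env_addA env_addC env_add0 env_addN.

Lemma env_mulA : associative env_mul.
Proof.
by elim/quotW=> a; elim/quotW=> b; elim/quotW=> c;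
  rewrite (env_pi_mul b c) (env_pi_mul a b) !env_pi_mul;
  apply/env_piP/EC_mulA.
Qed.

Lemma env_mul1l : left_id env_one env_mul.
Proof. by elim/quotW=> a; rewrite env_pi_mul; apply/env_piP/EC_mul1l. Qed.

Lemma env_mul1r : right_id env_one env_mul.
Proof. by elim/quotW=> a; rewrite env_pi_mul; apply/env_piP/EC_mul1r. Qed.

Lemma env_mulDl : left_distributive env_mul +%R.
Proof.
elim/quotW=> a; elim/quotW=> b; elim/quotW=> c.
rewrite [\pi_env a + _]env_pi_add (env_pi_mul a c) (env_pi_mul b c) env_pi_mul.
by rewrite [RHS]env_pi_add; apply/env_piP/EC_mulDl.
Qed.

Lemma env_mulDr : right_distributive env_mul +%R.
Proof.
elim/quotW=> a; elim/quotW=> b; elim/quotW=> c.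
rewrite [\pi_env b + _]env_pi_add (env_pi_mul a b) (env_pi_mul a c) env_pi_mul.
by rewrite [RHS]env_pi_add; apply/env_piP/EC_mulDr.
Qed.

HB.instance Definition _ :=
  GRing.Zmodule_isPzRing.Build env env_mulA env_mul1l env_mul1r
    env_mulDl env_mulDr.

Definition env_iota (x : L) : env := \pi_env (EGen x).

Lemma env_iotaD (x y : L) : env_iota (x + y) = env_iota x + env_iota y.
Proof. by rewrite [RHS]env_pi_add; apply/env_piP/EC_gen_add. Qed.

Lemma env_iota_bracket (x y : L) :
  env_iota (bracket x y) = env_iota x * env_iota y - env_iota y * env_iota x.
Proof.
rewrite [env_iota x * _]env_pi_mul [env_iota y * _]env_pi_mul [- _]env_pi_opp.
by rewrite [RHS]env_pi_add; apply/env_piP/EC_gen_bracket.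
Qed.

Section UniversalProperty.
Variables (R : pzRingType) (f : L -> R).

Fixpoint env_eval (a : env_term) : R :=
  match a with
  | EGen x => f x
  | EZero => 0
  | EOne => 1
  | EOpp b => - env_eval b
  | EAdd b c => env_eval b + env_eval c
  | EMul b c => env_eval b * env_eval c
  end.

Theorem env_universal :
  (forall x y, f (x + y) = f x + f y) ->
  (forall x y, f (bracket x y) = f x * f y - f y * f x) ->
  exists g : {rmorphism env -> R},
    (forall x, g (env_iota x) = f x) /\
    (forall h : {rmorphism env -> R}, (forall x, h (env_iota x) = f x) -> h =1 g).
Proof.
move=> fD fB.
have evalP a b : env_cong a b -> env_eval a = env_eval b.
  elim=> //= {a b}; try by move=> *; congruence.
  - by move=> *; rewrite addrA.
  - by move=> *; rewrite addrC.
  - by move=> *; rewrite add0r.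
  - by move=> *; rewrite addNr.
  - by move=> *; rewrite mulrA.
  - by move=> *; rewrite mul1r.
  - by move=> *; rewrite mulr1.
  - by move=> *; rewrite mulrDl.
  - by move=> *; rewrite mulrDr.
pose g (u : env) := env_eval (repr u).
have g_pi a : g (\pi_env a) = env_eval a by apply/evalP/env_repr_pi.
have gB : zmod_morphism g.
  elim/quotW=> a; elim/quotW=> b.
  by rewrite [- _]env_pi_opp [_ + _]env_pi_add !g_pi.
have gM : monoid_morphism g.
  split; first exact: g_pi.
  by elim/quotW=> a; elim/quotW=> b; rewrite [_ * _]env_pi_mul !g_pi.
pose ga := GRing.isZmodMorphism.Build _ _ g gB.
pose gm := GRing.isMonoidMorphism.Build _ _ g gM.
pose G : {rmorphism env -> R} := HB.pack g ga gm.
exists G; split=> [x|h hE]; first exact: g_pi.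
elim/quotW=> a; rewrite [G _]g_pi; elim: a => /= [x|||||].
- exact: hE.
- exact: (rmorph0 h).
- exact: (rmorph1 h).
- by move=> a <-; rewrite -env_pi_opp; apply: (rmorphN h).
- by move=> a <- b <-; rewrite -env_pi_add; apply: (rmorphD h).
- by move=> a <- b <-; rewrite -env_pi_mul; apply: (rmorphM h).
Qed.

End UniversalProperty.

Definition augmentation_ideal : set env := ideal_gen (range env_iota).

Definition dimension_subring (n : nat) : set L :=
  env_iota @^-1` ideal_exp augmentation_ideal n.

End EnvelopingAlgebra.
Arguments env_iota {L}.
Arguments dimension_subring : clear implicits.

(* Main.v *)
Require Import Defs.
From HB Require Import structures.
From mathcomp Require Import all_boot all_algebra boolp classical_sets.
From mathcomp Require Import generic_quotient ring_quotient functions.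

(** Modulo the third power of the augmentation ideal the enveloping algebra sees
    L / gamma_3 and the products of two elements of A := L / gamma_2, glued
    together by [x, y] = x y - y x.  An element of L that dies there is thus a
    sum of brackets [x_i, y_i] such that the sum of x_i (x) y_i - y_i (x) x_i
    vanishes in A (x) A, and the content of the theorem is that the map from
    the exterior square of A to A (x) A is injective for every abelian group A.

    This is used in a dual form that avoids tensor products: every alternating
    biadditive B : A -> A -> C becomes, after embedding C in a larger group D,
    of the form b(x, y) - b(y, x) with b biadditive (antisymmetrization).
    - If A is finitely generated, A is a direct sum of cyclic groups and, with
      x_k and y_l the components of x and y, one may take for b(x, y) the sum
      of B(x_k, y_l) over k < l; the diagonal terms B(x_k, y_k) vanish because
      B is alternating and the summands are cyclic.  The splitting is obtained
      one cyclic summand at a time (cyclic_splitting), from a relation between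
      generators with smallest positive coefficient.
    - For general A, a solution b_s is chosen on the subgroup generated by each
      finite sequence s, and D is the group of functions s |-> c_s modulo those
      that vanish for all large s: there the family (b_s) is biadditive.

    Given b for the bracket A -> A -> L / gamma_3, the group Z x A x D is a
    unital ring for (k, x, u) (l, y, v) = (k l, l x + k y, l u + k v + b(x, y)),
    and x |-> (0, x mod gamma_2, x mod gamma_3) turns brackets into commutators,
    hence extends to the enveloping algebra.  Products of three elements with
    vanishing integer component are zero, so an element of delta_3 is zero in
    L / gamma_3 (quadratic_augmentation_cube).  The converse inclusion holds in
    every degree (lcs_sub_dimension). *)

Set Implicit Arguments.
Unset Strict Implicit.
Unset Printing Implicit Defensive.

Import GRing.Theory.
Local Open Scope classical_set_scope.
Local Open Scope ring_scope.

(** * Generated subgroups, ideals and quotient groups *)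

Lemma subgroup_closedN (V : zmodType) (H : set V) x :
  subgroup_closed H -> H x -> H (- x).
Proof. by move=> [H0 HB] Hx; rewrite -sub0r; apply: HB. Qed.

Lemma subgroup_closedD (V : zmodType) (H : set V) x y :
  subgroup_closed H -> H x -> H y -> H (x + y).
Proof.
move=> Hsub Hx Hy; rewrite -[y]opprK; apply: Hsub.2 => //.
exact: subgroup_closedN.
Qed.

Lemma subgroup_genP (V : zmodType) (S : set V) : subgroup_closed (subgroup_gen S).
Proof.
split=> [M [[M0 _] _] //|x y Sx Sy M MS].
by case: (MS) => -[_ MB] _; apply: MB; [apply: Sx|apply: Sy].
Qed.

Lemma ideal_genP (R : pzRingType) (S : set R) : ideal_closed (ideal_gen S).
Proof.
split; first split=> [M [[[M0 _] _ _] _] //|x y Sx Sy M MS].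
- by case: (MS) => -[[_ MB] _ _] _; apply: MB; [apply: Sx|apply: Sy].
- by move=> a x Sx M MS; case: (MS) => -[_ Ml _] _; apply: Ml; apply: Sx.
- by move=> a x Sx M MS; case: (MS) => -[_ _ Mr] _; apply: Mr; apply: Sx.
Qed.

Lemma exists_quotient (V : zmodType) (H : set V) : subgroup_closed H ->
  exists (Q : zmodType) (p : {additive V -> Q}),
    (forall q, exists x, p x = q) /\ (forall x, p x = 0 <-> H x).
Proof.
move=> [H0 HB]; pose I : pred V := fun x => `[< H x >].
have Iz : zmod_closed I.
  split=> [|x y]; first exact/asboolP.
  by move=> /asboolP Hx /asboolP Hy; apply/asboolP/HB.
pose J : zmodClosed V := HB.pack I (GRing.isZmodClosed.Build V I Iz).
exists (Quotient.quot J), \pi_(Quotient.quot J)%qT; split.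
  by move=> q; exists (repr q); apply: reprK.
move=> x; have piE0 : (\pi_(Quotient.quot J)%qT x == 0) = (x \in J).
  by rewrite -[x in RHS]subr0 Quotient.idealrBE raddf0.
split=> [/eqP|Hx]; last apply/eqP; rewrite piE0; first by move/asboolP.
exact/asboolP.
Qed.

(** * Splitting a cyclic summand off a finitely generated abelian group *)

Section Splitting.
Variable A : zmodType.

Definition span n (h : 'I_n -> A) : set A :=
  [set x | exists c : 'I_n -> int, x = \sum_k h k *~ c k].

Lemma spanP n (h : 'I_n -> A) : subgroup_closed (span h).
Proof.
split=> [|_ _ [c ->] [d ->]].
  by exists (fun=> 0); rewrite big1 // => k _; rewrite mulr0z.
exists (fun k => c k - d k); rewrite -sumrB; apply: eq_bigr => k _.
by rewrite mulrzBr.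
Qed.

Lemma mem_span n (h : 'I_n -> A) k : span h (h k).
Proof.
exists (fun j => (j == k)%:Z); rewrite (bigD1 k) //= eqxx mulr1z big1 ?addr0 //.
by move=> j /negPf->; rewrite mulr0z.
Qed.

Lemma span_sub n (h : 'I_n -> A) (H : set A) : subgroup_closed H ->
  (forall k, H (h k)) -> span h `<=` H.
Proof.
move=> Hsub Hh _ [c ->]; apply: (big_ind H); first exact: Hsub.1.
  by move=> x y; apply: subgroup_closedD.
move=> k _; have Hn m : H (h k *+ m).
  elim: m => [|m IH]; first by rewrite mulr0n; exact: Hsub.1.
  by rewrite mulrS; apply: subgroup_closedD.
by case: (c k) => m; [|apply: subgroup_closedN => //]; apply: Hn.
Qed.

Lemma span_lift n (h : 'I_n.+1 -> A) i x :
  span h x <-> exists a, span (h \o lift i) (x - h i *~ a).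
Proof.
split=> [[c ->]|[a [c xE]]].
  exists (c i), (c \o lift i).
  by rewrite (bigD1_ord i) //= addrAC subrr add0r.
exists (fun k => if unlift i k is Some j then c j else a).
rewrite (bigD1_ord i) //= unlift_none; apply/eqP.
rewrite addrC -subr_eq xE; apply/eqP; apply: eq_bigr => k _ /=.
by rewrite liftK.
Qed.

(** The elementary change of generators that alters only the i-th one. *)
Definition shear n (i : 'I_n) (q : 'I_n -> int) (h : 'I_n -> A) : 'I_n -> A :=
  fun k => if k == i then h i + \sum_(j | j != i) h j *~ q j else h k.

Lemma span_shear n i q (h : 'I_n -> A) : span (shear i q h) = span h.
Proof.
have others (g : 'I_n -> A) (r : 'I_n -> int) (P : pred 'I_n) :
    span g (\sum_(j | P j) g j *~ r j).
  exists (fun j => if P j then r j else 0); rewrite big_mkcond /=.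
  by apply: eq_bigr => j _; case: (P j); rewrite ?mulr0z.
apply/seteqP; split; apply: span_sub (spanP _) _ => k.
  rewrite /shear; case: ifP => _; last exact: mem_span.
  by apply: subgroup_closedD (spanP _) (mem_span _ _) (others _ _ _).
have [->|ki] := eqVneq k i; last first.
  by have := mem_span (shear i q h) k; rewrite /shear (negPf ki).
have <- : shear i q h i - \sum_(j | j != i) shear i q h j *~ q j = h i.
  rewrite {1}/shear eqxx -addrA -sumrB big1 ?addr0 // => j ji.
  by rewrite /shear (negPf ji) subrr.
exact: (spanP _).2 (mem_span _ _) (others _ _ _).
Qed.

(** In a relation, a shear subtracts multiples of the i-th coefficient from the
    others: a step of the Euclidean algorithm when q k is the quotient of c k by
    c i. *)
Lemma sum_shear n i q (h : 'I_n -> A) (c : 'I_n -> int) :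
  \sum_k shear i q h k *~ (if k == i then c i else c k - q k * c i)
    = \sum_k h k *~ c k.
Proof.
rewrite (bigD1 i) //= [RHS](bigD1 i) //= /shear !eqxx mulrzDl -addrA.
congr (_ + _); rewrite mulrz_suml -big_split /=; apply: eq_bigr => j /negPf->.
by rewrite -mulrzA -mulrzDr addrC subrK.
Qed.

(** The conclusion says that span g is the direct sum of the cyclic group
    generated by g i and the span of the other generators.  Among all relations
    between n.+1 generators of the same group, take one with a smallest positive
    coefficient d, at index i.  Dividing its other coefficients by d and shearing
    leaves remainders smaller than d, hence zero, so that d kills the new i-th
    generator; by minimality d also divides the i-th coefficient of every other
    relation.  If there is no nonzero relation the generators are free. *)
Lemma cyclic_splitting n (h : 'I_n.+1 -> A) :
  exists (g : 'I_n.+1 -> A) (i : 'I_n.+1), span g = span h /\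
    forall e : 'I_n.+1 -> int, \sum_k g k *~ e k = 0 -> g i *~ e i = 0.
Proof.
pose coef (d : nat) := exists (g : 'I_n.+1 -> A) (c : 'I_n.+1 -> int) i,
  [/\ span g = span h, \sum_k g k *~ c k = 0 & c i = d :> int].
have [ex_d|no_coef] := pselect (exists d, `[< (0 < d)%N /\ coef d >]).
  have [d] := ex_minnP ex_d.
  move=> /asboolP[d_gt0 [g [c [i [gE cE ci]]]]] d_min.
  have small (g' : 'I_n.+1 -> A) c' j :
      span g' = span h -> \sum_k g' k *~ c' k = 0 ->
      c' j = (c' j %% d)%Z -> c' j = 0.
    move=> g'E c'E; have := modz_ge0 (c' j) (_ : d%:Z != 0).
    have := ltz_pmod (c' j) (_ : 0 < d%:Z).
    move=> /(_ d_gt0) lt_d /(_ (lt0n_neq0 d_gt0)) ge0 c'j.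
    move: lt_d ge0; rewrite -c'j; case c'jE: (c' j) => [m|//] m_d _.
    apply/eqP/contraT => m_neq0; move: m_d; rewrite ltz_nat ltnNge d_min //.
    by apply/asboolP; rewrite lt0n; split=> //; exists g', c', j.
  pose q k := (c k %/ d)%Z; pose g1 := shear i q g.
  have g1E : span g1 = span h by rewrite span_shear.
  (* The sheared relation has coefficient d at i and c k mod d elsewhere. *)
  have dg1 : g1 i *~ d = 0.
    have := cE; rewrite -(sum_shear i q) => c1E.
    move: (c1E); rewrite (bigD1 i) //= eqxx ci big1 ?addr0 // => k ki.
    have ckE : c k - q k * d = (c k %% d)%Z.
      by rewrite {1}(divz_eq (c k) d) addrAC subrr add0r.
    have := small _ _ k g1E c1E; rewrite (negPf ki) ci ckE modz_mod.
    by move=> ->; rewrite // mulr0z.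
  exists g1, i; split=> // e eE.
  (* As d kills g1 i, the coefficient e i may be reduced modulo d. *)
  pose e1 k := if k == i then (e i %% d)%Z else e k.
  have g1e : g1 i *~ e i = g1 i *~ (e i %% d)%Z.
    rewrite {1}(divz_eq (e i) d) mulrzDr mulrC mulrzA dg1.
    by rewrite mul0rz add0r.
  have e1E : \sum_k g1 k *~ e1 k = 0.
    rewrite -[RHS]eE; apply: eq_bigr => k _; rewrite /e1.
    by case: eqVneq => [->|//]; rewrite g1e.
  have := small _ _ i g1E e1E; rewrite /e1 eqxx modz_mod => /(_ erefl) ei0.
  by rewrite g1e ei0 mulr0z.
exists h, ord0; split=> // e eE.
have nat_coef (c : 'I_n.+1 -> int) m :
    \sum_k h k *~ c k = 0 -> c ord0 = m%:Z -> m = 0%N.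
  move=> cE c0; apply/eqP/contraT => m_neq0; case: no_coef; exists m.
  by apply/asboolP; rewrite lt0n; split=> //; exists h, c, ord0.
case e0: (e ord0) => [m|m].
  by rewrite (nat_coef e m) ?mulr0z.
have := nat_coef (fun k => - e k) m.+1 _ _; rewrite e0 NegzE opprK => -> //.
under eq_bigr do rewrite mulrNz.
by rewrite sumrN eE oppr0.
Qed.

End Splitting.

(** * Alternating maps are antisymmetrizations *)

(** Relative to a subset, because the maps are first built on finitely generated
    subgroups, without any condition elsewhere. *)
Definition biadditive_on (A C : zmodType) (S : set A) (b : A -> A -> C) : Prop :=
  forall x y z, S x -> S y -> S z ->
    b (x + y) z = b x z + b y z /\ b z (x + y) = b z x + b z y.

Section Biadditive.
Variables (A C : zmodType) (b : A -> A -> C).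
Hypothesis b_biadd : biadditive_on setT b.

Lemma biadditiveDl x y z : b (x + y) z = b x z + b y z.
Proof. by have [] := @b_biadd x y z I I I. Qed.

Lemma biadditiveDr x y z : b z (x + y) = b z x + b z y.
Proof. by have [] := @b_biadd x y z I I I. Qed.

Lemma biadditive_mulzl x y n : b (x *~ n) y = b x y *~ n.
Proof.
have bB : zmod_morphism (b^~ y).
  by move=> u v; apply/eqP; rewrite eq_sym subr_eq -biadditiveDl subrK.
pose f : {additive A -> C} :=
  HB.pack (b^~ y) (GRing.isZmodMorphism.Build _ _ _ bB).
exact: (raddfMz f).
Qed.

Lemma biadditive_mulzr x y n : b x (y *~ n) = b x y *~ n.
Proof.
have bB : zmod_morphism (b x).
  by move=> u v; apply/eqP; rewrite eq_sym subr_eq -biadditiveDr subrK.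
pose f : {additive A -> C} :=
  HB.pack (b x) (GRing.isZmodMorphism.Build _ _ _ bB).
exact: (raddfMz f).
Qed.

Lemma biadditive0l y : b 0 y = 0.
Proof. by rewrite -(mulr0z 0) biadditive_mulzl. Qed.

Lemma biadditive0r x : b x 0 = 0.
Proof. by rewrite -(mulr0z 0) biadditive_mulzr. Qed.

End Biadditive.

Section Alternating.
Variables (A C : zmodType) (B : A -> A -> C).
Hypotheses (B_biadd : biadditive_on setT B) (B_alt : forall x, B x x = 0).

Let BDl := biadditiveDl B_biadd.
Let BDr := biadditiveDr B_biadd.

Lemma alternating_skew x y : B y x = - B x y.
Proof.
apply/eqP; rewrite -addr_eq0; have := B_alt (x + y).
by rewrite BDl !BDr !B_alt add0r addr0 addrC => ->.
Qed.

Lemma alternating_cyclic x m n : B (x *~ m) (x *~ n) = 0.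
Proof.
by rewrite (biadditive_mulzl B_biadd) (biadditive_mulzr B_biadd) B_alt !mul0rz.
Qed.

(** Induction on the number of generators.  With p the projection onto the cyclic
    summand and r = id - p, a solution is b'(r x, r y) + B(p x, r y), where b'
    solves the problem on the complement. *)
Lemma antisymmetrization_fg n (h : 'I_n -> A) :
  exists b : A -> A -> C, biadditive_on (span h) b /\
    forall x y, span h x -> span h y -> b x y - b y x = B x y.
Proof.
elim: n h => [|n IHn] h.
  have span0 x : span h x -> x = 0 by move=> [c ->]; rewrite big_ord0.
  exists (fun _ _ => 0); split=> [x y z _ _ _|x y /span0 -> /span0 ->].
    by rewrite addr0.
  by rewrite B_alt subr0.
have [g [i [<- g_free]]] := cyclic_splitting h.
have [b [bD bB]] := IHn (g \o lift i).
have /choice[p pP] : forall x, exists u, span g x ->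
    (exists a, u = g i *~ a) /\ span (g \o lift i) (x - u).
  move=> x; have [/(span_lift _ i)[a ga]|] := pselect (span g x).
    by exists (g i *~ a) => _; split=> //; exists a.
  by move=> gx; exists 0.
pose r x := x - p x.
have subD x y : span g x -> span g y -> span g (x + y).
  exact: subgroup_closedD (spanP g).
(* The defect of additivity of p lies in both summands, hence is zero. *)
have pD x y : span g x -> span g y -> p (x + y) = p x + p y.
  move=> gx gy; have [[a pa] ra] := pP _ (subD _ _ gx gy).
  have [[a1 pa1] ra1] := pP _ gx; have [[a2 pa2] ra2] := pP _ gy.
  have span_r := spanP (g \o lift i).
  have [c cE] := span_r.2 _ _ (subgroup_closedD span_r ra1 ra2) ra.
  apply/eqP; rewrite -subr_eq0 pa pa1 pa2 -mulrzDr -mulrzBr; apply/eqP.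
  pose e k := if unlift i k is Some j then - c j else a - (a1 + a2).
  have -> : a - (a1 + a2) = e i by rewrite /e unlift_none.
  apply: g_free; rewrite (bigD1_ord i) //= /e unlift_none.
  under eq_bigr do rewrite liftK mulrNz.
  rewrite sumrN -[X in _ - X]cE mulrzBr mulrzDr -pa -pa1 -pa2.
  rewrite [x - _ + _]addrACA -opprD opprB.
  by rewrite opprB [x + y - _ + _]addrC !subrKA subrr.
have rD x y : span g x -> span g y -> r (x + y) = r x + r y.
  by move=> gx gy; rewrite /r pD // opprD addrACA.
exists (fun x y => b (r x) (r y) + B (p x) (r y)); split.
  move=> x y z gx gy gz.
  have [[[_ rx] [_ ry]] [_ rz]] := (pP _ gx, pP _ gy, pP _ gz).
  have [bl br] := bD (r x) (r y) (r z) rx ry rz.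
  by rewrite !rD // !pD // bl br BDl BDr; split; rewrite addrACA.
move=> x y gx gy.
have [[[a pa] rx] [[a' pa'] ry]] := (pP _ gx, pP _ gy).
have -> : B x y =
    B (r x) (r y) + B (r x) (p y) + (B (p x) (r y) + B (p x) (p y)).
  by rewrite -!BDr -BDl !subrK.
rewrite opprD addrACA bB // -alternating_skew.
have -> : B (p x) (p y) = 0 by rewrite pa pa' alternating_cyclic.
by rewrite addr0 -addrA; congr (_ + _); rewrite addrC.
Qed.

End Alternating.

(** Enlarging C is what makes local solutions glue: nothing relates the maps b_s
    on different finitely generated subgroups, but in the group of functions of
    s modulo eventual equality each identity need only hold for all s containing
    the finitely many elements involved.  Constant functions embed C. *)
Theorem antisymmetrization (A C : zmodType) (B : A -> A -> C) :
  biadditive_on setT B -> (forall x, B x x = 0) ->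
  exists (D : zmodType) (j : {additive C -> D}) (b : A -> A -> D),
    [/\ forall c, j c = 0 -> c = 0, biadditive_on setT b &
        forall x y, b x y - b y x = j (B x y)].
Proof.
move=> B_biadd B_alt.
have /choice[b bP] : forall s : seq A, exists b : A -> A -> C,
    let S := span (fun k : 'I_(size s) => s`_k) in
    biadditive_on S b /\ forall x y, S x -> S y -> b x y - b y x = B x y.
  by move=> s; apply: antisymmetrization_fg.
have mem_S (s : seq A) x : x \in s -> span (fun k : 'I_(size s) => s`_k) x.
  move=> xs; rewrite -(nth_index 0 xs).
  have lt_s : (index x s < size s)%N by rewrite index_mem.
  exact: (mem_span _ (Ordinal lt_s)).
pose H := [set f : seq A -> C | exists s0 : seq A,
  forall s : seq A, {subset s0 <= s} -> f s = 0].
have Hsub : subgroup_closed H.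
  split=> [|f g [s fs] [t gt]]; first by exists [::].
  exists (s ++ t) => u stu; have -> : (f - g) u = f u - g u by [].
  rewrite fs ?gt ?subrr //.
    by move=> x xt; apply: stu; rewrite mem_cat xt orbT.
  by move=> x xs; apply: stu; rewrite mem_cat xs.
have [D [p [_ pE]]] := exists_quotient Hsub.
have eq_p (f g : seq A -> C) (s0 : seq A) :
    (forall s : seq A, {subset s0 <= s} -> f s = g s) -> p f = p g.
  move=> fg; apply/eqP; rewrite -subr_eq0 -raddfB; apply/eqP/pE.
  exists s0 => s /fg fgs; have -> : (f - g) s = f s - g s by [].
  by rewrite fgs subrr.
have jB : zmod_morphism (fun c : C => p (fun=> c)).
  by move=> c d; rewrite -raddfB.
pose j : {additive C -> D} :=
  HB.pack (fun c : C => p (fun=> c)) (GRing.isZmodMorphism.Build _ _ _ jB).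
exists D, j, (fun x y => p (fun s => b s x y)); split.
- by move=> c /pE[s0 /(_ s0)]; apply.
- move=> x y z _ _ _; rewrite -!raddfD.
  by split; apply: (eq_p _ _ [:: x; y; z]) => s ss; have [bD _] := bP s;
    have [] := bD x y z => //; apply/mem_S/ss; rewrite !inE eqxx ?orbT.
- move=> x y; rewrite -raddfB; apply: (eq_p _ _ [:: x; y]) => s ss.
  by apply: (bP s).2; apply/mem_S/ss; rewrite !inE eqxx ?orbT.
Qed.

(** * The ring attached to a biadditive map *)

Section QuadraticRing.
Variables (A D : zmodType) (b : A -> A -> D).
Hypothesis b_biadd : biadditive_on setT b.

(** Indexed by the proof that b is biadditive, on which its ring structure
    depends. *)
Definition quadratic_ring of biadditive_on setT b : Type := (int * A * D)%type.
Local Notation Q := (quadratic_ring b_biadd).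

HB.instance Definition _ := GRing.Zmodule.on Q.

Let bDl := biadditiveDl b_biadd.
Let bDr := biadditiveDr b_biadd.
Let bMl := biadditive_mulzl b_biadd.
Let bMr := biadditive_mulzr b_biadd.

Definition quad_one : Q := (1, 0, 0).

Definition quad_mul (u v : Q) : Q :=
  (u.1.1 * v.1.1, u.1.2 *~ v.1.1 + v.1.2 *~ u.1.1,
   u.2 *~ v.1.1 + v.2 *~ u.1.1 + b u.1.2 v.1.2).

Lemma quad_mulA : associative quad_mul.
Proof.
move=> [[k x] u] [[l y] v] [[m z] w]; rewrite /quad_mul /=; congr (_, _, _).
- exact: mulrA.
- by rewrite !mulrzDl -!mulrzA addrA [l * k]mulrC [k * m]mulrC.
- rewrite bDl bDr !bMl !bMr !mulrzDl -!mulrzA.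
  rewrite [l * k]mulrC [k * m]mulrC -!addrA; congr (_ + (_ + _)).
  by rewrite [RHS]addrCA; congr (_ + _); rewrite addrC -addrA.
Qed.

Lemma quad_mul1l : left_id quad_one quad_mul.
Proof.
move=> [[k x] u]; rewrite /quad_mul /= biadditive0l //.
by rewrite !mul0rz mul1r !mulr1z !add0r addr0.
Qed.

Lemma quad_mul1r : right_id quad_one quad_mul.
Proof.
move=> [[k x] u]; rewrite /quad_mul /= biadditive0r //.
by rewrite !mul0rz mulr1 !mulr1z !addr0.
Qed.

Lemma quad_mulDl : left_distributive quad_mul +%R.
Proof.
move=> [[k x] u] [[l y] v] [[m z] w]; rewrite /quad_mul /=; congr (_, _, _).
- exact: mulrDl.
- by rewrite /= mulrzDl mulrzDr addrACA.
- by rewrite /= bDl mulrzDl mulrzDr [in LHS](addrACA (u *~ m)) [LHS]addrACA.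
Qed.

Lemma quad_mulDr : right_distributive quad_mul +%R.
Proof.
move=> [[k x] u] [[l y] v] [[m z] w]; rewrite /quad_mul /=; congr (_, _, _).
- exact: mulrDr.
- by rewrite /= mulrzDl mulrzDr addrACA.
- by rewrite /= bDr mulrzDl mulrzDr [in LHS](addrACA (u *~ l)) [LHS]addrACA.
Qed.

HB.instance Definition _ := GRing.Zmodule_isPzRing.Build Q
  quad_mulA quad_mul1l quad_mul1r quad_mulDl quad_mulDr.

Lemma quad_mulE (u v : Q) : u * v =
  (u.1.1 * v.1.1, u.1.2 *~ v.1.1 + v.1.2 *~ u.1.1,
   u.2 *~ v.1.1 + v.2 *~ u.1.1 + b u.1.2 v.1.2).
Proof. by []. Qed.

End QuadraticRing.

(** * The lower central series lies in the dimension series *)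

Lemma ideal_exp_closed (R : pzRingType) (I : set R) n :
  subgroup_closed (ideal_exp I n).
Proof. by case: n => [|n]; [split|apply: subgroup_genP]. Qed.

Lemma ideal_expS_mull (R : pzRingType) (I : set R) n a x :
  I a -> ideal_exp I n x -> ideal_exp I n.+1 (a * x).
Proof. by move=> Ia Ix; apply: sub_gen_smallest; exists a => //; exists x. Qed.

Lemma ideal_expS_mulr (R : pzRingType) (I : set R) n x a :
  ideal_closed I -> ideal_exp I n x -> I a -> ideal_exp I n.+1 (x * a).
Proof.
move=> Iid + Ia; elim: n x => [|n IH] x.
  by move=> _; rewrite ideal_exp1 //; case: Iid => _ Il _; apply: Il.
suff: ideal_exp I n.+1 `<=` [set y | ideal_exp I n.+2 (y * a)] by apply.
apply: smallest_sub => [|_ [c Ic [y Iy <-]]].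
  split=> [|u v Iu Iv] /=.
    by rewrite mul0r; apply: (ideal_exp_closed I n.+2).1.
  by rewrite mulrBl; apply: (ideal_exp_closed I n.+2).2.
by rewrite /= -mulrA; apply: (@ideal_expS_mull _ _ n.+1) => //; apply: IH.
Qed.

(** For x in L and y in gamma_n both terms of [x, y] = x y - y x lie in the next
    power of the augmentation ideal; for y x this uses that powers may also be
    extended by a factor on the right (ideal_expS_mulr). *)
Lemma lcs_sub_dimension (L : lieRingType) n :
  lcs L n.+1 `<=` dimension_subring L n.+1.
Proof.
have aug_id : ideal_closed (@augmentation_ideal L) by apply: ideal_genP.
have aug_iota x : @augmentation_ideal L (env_iota x).
  by apply: sub_gen_smallest; exists x.
have iotaB (x y : L) : env_iota (x - y) = env_iota x - env_iota y.
  by apply/eqP; rewrite eq_sym subr_eq -env_iotaD subrK.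
elim: n => [|n IH].
  by move=> x _; rewrite /dimension_subring ideal_exp1 //; apply: aug_iota.
have exp_sub := ideal_exp_closed (@augmentation_ideal L) n.+2.
apply: smallest_sub => [|_ [x _ [y /IH dy <-]]].
  split=> [|x y dx dy].
    by rewrite /dimension_subring /= -[0]subr0 iotaB subrr; apply: exp_sub.1.
  by rewrite /dimension_subring /= iotaB; apply: exp_sub.2.
rewrite /dimension_subring /= env_iota_bracket; apply: exp_sub.2.
  exact: ideal_expS_mull.
exact: ideal_expS_mulr.
Qed.

(** * The third dimension subring *)

Lemma bracket_skew (L : lieRingType) (x y : L) : bracket y x = - bracket x y.
Proof.
apply: alternating_skew bracketxx _ _ => u v w _ _ _.
by rewrite bracketDl bracketDr.
Qed.

Lemma ideal_mul_sub (R : pzRingType) (I J H : set R) : subgroup_closed H ->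
  (forall x y, I x -> J y -> H (x * y)) -> ideal_mul I J `<=` H.
Proof.
by move=> Hsub HIJ; apply: smallest_sub => // _ [x Ix [y Jy <-]]; apply: HIJ.
Qed.

(** The first power of the augmentation ideal kills the integer component, the
    second one also the component in A, and the third one everything. *)
Lemma quadratic_augmentation_cube (L : lieRingType) (A D : zmodType)
    (b : A -> A -> D) (b_biadd : biadditive_on setT b)
    (g : {rmorphism env L -> quadratic_ring b_biadd}) :
  (forall x, (g (env_iota x)).1.1 = 0) ->
  forall u, ideal_exp (@augmentation_ideal L) 3 u -> g u = 0.
Proof.
move=> g_iota.
have aug0 u : augmentation_ideal u -> (g u).1.1 = 0.
  suff: @augmentation_ideal L `<=` [set u | (g u).1.1 = 0] by apply.
  apply: smallest_sub => [|_ [x _ <-]]; last exact: g_iota.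
  split=> [|a x /= gx|a x /= gx]; last 2 first.
  - by rewrite rmorphM /= gx mulr0.
  - by rewrite rmorphM /= gx mul0r.
  by split=> [|x y /= gx gy]; rewrite /= ?rmorph0 // rmorphB /= gx gy subrr.
have sq0 u : ideal_exp (@augmentation_ideal L) 2 u -> (g u).1 = 0.
  suff: ideal_exp (@augmentation_ideal L) 2 `<=` [set u | (g u).1 = 0] by apply.
  apply: (@ideal_mul_sub _ _ (ideal_exp _ 1)) => [|x y /aug0 gx].
    by split=> [|x y /= gx gy]; rewrite /= ?rmorph0 // rmorphB /= gx gy subrr.
  rewrite ideal_exp1 => [/aug0 gy|]; last exact: ideal_genP.
  by rewrite /= rmorphM /= gx gy mul0r !mulr0z addr0.
move=> u; apply: (@ideal_mul_sub _ _ _ [set u | g u = 0]).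
  by split=> [|x y /= gx gy]; rewrite /= ?rmorph0 // rmorphB /= gx gy subrr.
move=> x y /aug0 gx /sq0 gy.
rewrite /= rmorphM quad_mulE gx gy /= biadditive0r //.
by rewrite mul0r !mulr0z !addr0.
Qed.

Theorem theorem4p5 (L : lieRingType) : dimension_subring L 3 = lcs L 3.
Proof.
apply/seteqP; split; last exact: lcs_sub_dimension.
have lcsP n : subgroup_closed (lcs L n).
  by case: n => [|[|n]]; [split|split|apply: subgroup_genP].
have lcs_bracket n (x y : L) : lcs L n.+1 y -> lcs L n.+2 (bracket x y).
  by move=> Ly; apply: sub_gen_smallest; exists x => //; exists y.
have [A [pA [pA_surj pA0]]] := exists_quotient (lcsP 2).
have [C [pC [_ pC0]]] := exists_quotient (lcsP 3).
have [s sK] := choice pA_surj.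
(* Modulo gamma_3 the bracket only depends on its arguments modulo gamma_2, so
   that it may be computed on the representatives s. *)
have pC_bracket (x y : L) :
    pC (bracket (s (pA x)) (s (pA y))) = pC (bracket x y).
  have pCl (z t : L) : pC (bracket (s (pA z)) t) = pC (bracket z t).
    have bB : zmod_morphism (bracket^~ t).
      by move=> u v; apply/eqP; rewrite eq_sym subr_eq -bracketDl subrK.
    apply/eqP; rewrite -subr_eq0 -raddfB -bB bracket_skew; apply/eqP/pC0.
    apply: (subgroup_closedN (lcsP 3)); apply: (lcs_bracket 1%N); apply/pA0.
    by rewrite raddfB sK subrr.
  by rewrite pCl bracket_skew raddfN pCl -raddfN -bracket_skew.
pose B a a' := pC (bracket (s a) (s a')).
have B_biadd : biadditive_on setT B.
  move=> a a' a'' _ _ _; rewrite /B -raddfD -bracketDl -raddfD -bracketDr.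
  by rewrite -!(pC_bracket (_ + _)) -!(pC_bracket _ (_ + _)) !raddfD !sK.
have B_alt a : B a a = 0 by rewrite /B bracketxx raddf0.
have [D [j [b [j_inj b_biadd bB]]]] := antisymmetrization B_biadd B_alt.
pose f x : quadratic_ring b_biadd := (0, pA x, j (pC x)).
have fD x y : f (x + y) = f x + f y.
  by rewrite /f !raddfD.
have f_bracket x y : f (bracket x y) = f x * f y - f y * f x.
  have pA_bracket : pA (bracket x y) = 0 by apply/pA0; apply: (lcs_bracket 0%N).
  rewrite !quad_mulE /f /= pA_bracket -pC_bracket -bB.
  by rewrite !mulr0z mul0r !add0r; congr (_, _, _); rewrite subrr.
have [g [g_iota _]] := env_universal fD f_bracket.
move=> x /(@quadratic_augmentation_cube _ _ _ _ b_biadd g).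
rewrite g_iota => /(_ (fun y => congr1 (fun u => u.1.1) (g_iota y)))[_].
by move/j_inj/pC0.
Qed.
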